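(* Let $r\geq3$, let $\mathbf{K}$ be the random $K_r$-free graph (the Fraïssé limit of the class of finite graphs with no clique of size $r$) and $G=\mathrm{Aut}(\mathbf{K})$. Let $\mathbf{A}_2\subseteq\mathbf{K}$ be a substructure consisting of two vertices joined by an edge, and $H_2=\mathrm{Emb}(\mathbf{A}_2,\mathbf{K})$. Suppose $T\subseteq H_2$ is such that the $G$-orbit of $\chi_T$ is dense in $2^{H_2}$. Then for every finite substructure $\mathbf{A}_n$ of $\mathbf{K}$ with $\mathbf{A}_2\subseteq\mathbf{A}_n$, the set $\{s\in\mathrm{Emb}(\mathbf{A}_n,\mathbf{K}):s|_{\mathbf{A}_2}\in T\}$ does not belong to the Boolean algebra of subsets of $\mathrm{Emb}(\mathbf{A}_n,\mathbf{K})$ generated by the minimal subsets of $\mathrm{Emb}(\mathbf{A}_n,\mathbf{K})$ (i.e. $T\notin B'_2$).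
   Context: For a finite substructure $\mathbf{A}\subseteq\mathbf{K}$, identify subsets of $H=\mathrm{Emb}(\mathbf{A},\mathbf{K})$ with $2^{H}$ (product topology), with right $G$-action $(\chi\cdot g)(f)=\chi(g\circ f)$. A set $S\subseteq H$ is minimal if the orbit closure $\overline{\chi_S\cdot G}\subseteq 2^H$ is a minimal $G$-flow (every orbit dense). *)

(* Defs.v *)
From HB Require Import structures.
From mathcomp Require Import all_boot.
From mathcomp Require Export finmap.
Set Implicit Arguments. Unset Strict Implicit. Unset Printing Implicit Defensive.
Local Open Scope fset_scope.

Section Defs.
Variable E : rel nat.

Definition clique (s : seq nat) : bool := uniq s && pairwise E s.

(* E is the random K_r-free graph (Henson graph): a countably infinite simple
   graph which is K_r-free and has the one-point extension property
   characterising the Fraisse limit of finite K_r-free graphs. *)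
Definition random_Kr_free_graph (r : nat) : Prop :=
  [/\ irreflexive E, symmetric E,
      (forall s, clique s -> size s < r) &
      (forall U V : seq nat,
         all (fun u => u \notin V) U ->
         (forall s, {subset s <= U} -> clique s -> size s < r.-1) ->
         exists z, [/\ z \notin U, z \notin V, all (E z) U &
                       all (fun v => ~~ E z v) V])].

Definition is_emb (A : {fset nat}) (f : {ffun A -> nat}) : bool :=
  injectiveb f && [forall x : A, forall y : A, E (f x) (f y) == E (val x) (val y)].

Definition Emb (A : {fset nat}) := {f : {ffun A -> nat} | is_emb f}.

Record aut := Aut {
  autf :> nat -> nat;
  aut_bij : bijective autf;
  aut_hom : forall x y, E (autf x) (autf y) = E x y }.

Lemma comp_emb_proof A (g : aut) (f : Emb A) : is_emb [ffun x => g (val f x)].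
Proof.
case: f => f /= Hf; case/andP: Hf => /injectiveP fi /forallP fe; apply/andP; split.
  apply/injectiveP => x y; rewrite !ffunE => h; apply: fi.
  exact: (bij_inj (aut_bij g) h).
apply/forallP => x; apply/forallP => y; rewrite !ffunE aut_hom.
exact: (forallP (fe x) y).
Qed.

Definition comp_emb A (g : aut) (f : Emb A) : Emb A :=
  exist (@is_emb A) _ (comp_emb_proof g f).

Lemma restr_emb_proof A B (sub : A `<=` B) (f : Emb B) :
  is_emb [ffun x : A => val f (fincl sub x)].
Proof.
case: f => f /= Hf; case/andP: Hf => /injectiveP fi /forallP fe; apply/andP; split.
  apply/injectiveP => x y; rewrite !ffunE => h; apply: (@fincl_inj _ _ _ sub).
  exact: fi h.
apply/forallP => x; apply/forallP => y; rewrite !ffunE /=.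
exact: (forallP (fe (fincl sub x)) (fincl sub y)).
Qed.

Definition restr A B (sub : A `<=` B) (f : Emb B) : Emb A :=
  exist (@is_emb A) _ (restr_emb_proof sub f).

Definition act A (chi : Emb A -> bool) (g : aut) : Emb A -> bool :=
  fun f => chi (comp_emb g f).

(* psi lies in the closure (product topology on 2^H) of the G-orbit of chi:
   every basic open neighbourhood of psi (determined by finitely many
   coordinates) meets the orbit. *)
Definition in_orbit_closure A (chi psi : Emb A -> bool) : Prop :=
  forall F : seq (Emb A), exists g : aut, forall f, f \in F -> act chi g f = psi f.

Definition dense_orbit A (chi : Emb A -> bool) : Prop :=
  forall psi, in_orbit_closure chi psi.

(* S is minimal: the orbit closure Y of chi_S is a minimal G-flow, i.e.
   every G-orbit of a point of Y is dense in Y. *)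
Definition minimal_set A (S : Emb A -> bool) : Prop :=
  forall psi, in_orbit_closure S psi ->
  forall phi, in_orbit_closure S phi -> in_orbit_closure psi phi.

Inductive minimal_BA A : (Emb A -> bool) -> Prop :=
| BA_min S : minimal_set S -> minimal_BA S
| BA_empty : minimal_BA (fun _ => false)
| BA_compl S : minimal_BA S -> minimal_BA (fun x => ~~ S x)
| BA_union S1 S2 : minimal_BA S1 -> minimal_BA S2 -> minimal_BA (fun x => S1 x || S2 x)
| BA_ext S S' : minimal_BA S -> (forall x, S x = S' x) -> minimal_BA S'.

End Defs.

(* Main.v *)
Require Import Defs.
From HB Require Import structures.
From mathcomp Require Import all_boot finmap.
From Stdlib Require Import Classical_Prop.
Set Implicit Arguments. Unset Strict Implicit. Unset Printing Implicit Defensive.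

(** Identify the vertices of K with the natural numbers.  By the Nesetril-Rodl
theorem for K_r-free graphs (Hales-Jewett and two partite constructions), every
set S of embeddings of A_n agrees, on a copy of any finite part of K, with a
set phi defined by the order type of the embedding for the order of nat.
Hence phi lies in the orbit closure of S, and if S is minimal then S lies in
the orbit closure of phi: on every finite set of embeddings S is
determined by the order types for some linear order of the vertices.  A
Boolean combination of k minimal sets is then determined, on finite sets, by k
orders.  In the blow-up of A_n with m copies of every vertex these orders
give at most [(n m + 1) ^ (n m k)] patterns, whereas a dense orbit realises all
[2 ^ (m ^ 2)] patterns on the pairs of copies of the two vertices of A_2. *)

(** * The Hales-Jewett theorem *)

(** A combinatorial line is a word over [option T] whose [None] entries are the moving
    coordinates. *)
Definition subst_line (T : Type) (a : T) (w : seq (option T)) : seq T :=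
  map (odflt a) w.

Definition mono_line (T : eqType) (Q : Type) (s : seq T) (chi : seq T -> Q)
    (w : seq (option T)) :=
  None \in w /\
  {in s &, forall a b, chi (subst_line a w) = chi (subst_line b w)}.

Lemma subst_const (T : Type) (a : T) (u : seq T) :
  subst_line a (map Some u) = u.
Proof. by rewrite /subst_line -map_comp map_id. Qed.

Lemma subst_cat (T : Type) (a : T) (v w : seq (option T)) :
  subst_line a (v ++ w) = subst_line a v ++ subst_line a w.
Proof. exact: map_cat. Qed.

(** All the lines pass through the point [u] at the letter [a0]. They are monochromatic on [s], and
    their colours, read off at [a1], are pairwise distinct. *)
Definition focused_lines (T : eqType) (Q : eqType) (s : seq T) (a0 a1 : T)
    (chi : seq T -> Q) (L : nat) (ws : seq (seq (option T))) (u : seq T) :=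
  [/\ size u = L,
      forall w, w \in ws ->
        [/\ size w = L, subst_line a0 w = u & mono_line s chi w] &
      uniq [seq chi (subst_line a1 w) | w <- ws]].

(** Colour focusing, by induction on [j]: either the focused family grows by one line, or the colour
    of its focus makes one of its lines monochromatic at [a0] as well. *)
Lemma focusing_step (T Q : finType) (s : seq T) (a0 a1 : T) :
  a1 \in s ->
  (forall Q' : finType, exists L, forall chi : seq T -> Q',
     exists2 w, size w = L & mono_line s chi w) ->
  forall j, exists L, forall chi : seq T -> Q,
    (exists2 w, size w = L & mono_line (a0 :: s) chi w) \/
    exists ws u, size ws = j /\ focused_lines s a0 a1 chi L ws u.
Proof.
move=> a1s IH; elim=> [|j [L HL]].
  exists 0 => chi; right; exists [::], [::].
  by split=> //; split.
(* A prefix is coloured by the whole colouring of its extensions by [L] letters, so along the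
   resulting line [v] no extension notices which letter of [s] is substituted. *)
have [L' HL'] := IH {ffun L.-tuple T -> Q}.
exists (L' + L) => chi.
have [v sv [vN vmono]] :=
  HL' (fun x => [ffun y : L.-tuple T => chi (x ++ y)]).
have vE a y : a \in s -> size y = L ->
    chi (subst_line a v ++ y) = chi (subst_line a1 v ++ y).
  move=> sa /eqP sy.
  have /ffunP/(_ (Tuple sy)) := vmono _ _ sa a1s.
  by rewrite !ffunE.
have prefix_line w : size w = L ->
    mono_line (a0 :: s) (fun y => chi (subst_line a1 v ++ y)) w ->
    exists2 w, size w = L' + L & mono_line (a0 :: s) chi w.
  move=> sw [wN wm]; exists (map Some (subst_line a1 v) ++ w).
    by rewrite size_cat !size_map sv sw.
  split; first by rewrite mem_cat wN orbT.
  by move=> a b aS bS; rewrite !subst_cat !subst_const; apply: wm.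
case: (HL (fun y => chi (subst_line a1 v ++ y)))
  => [[w sw wm]|[ws [u [sws [su wsP wsU]]]]].
  by left; apply: prefix_line wm.
(* If [u] has the colour of a line [w], then [w] is monochromatic at [a0] too. Otherwise [v]
   followed by the constant word [u] is a line of a new colour. *)
have [/mapP[w wws cw]|uN] :=
  boolP (chi (subst_line a1 v ++ u) \in
    [seq chi (subst_line a1 v ++ subst_line a1 w) | w <- ws]).
  left; have [sw fw [wN wm]] := wsP _ wws.
  apply: (prefix_line w) => //; split=> // a b.
  have E a' : a' \in a0 :: s -> chi (subst_line a1 v ++ subst_line a' w)
     = chi (subst_line a1 v ++ subst_line a1 w).
    rewrite inE => /orP[/eqP->|a's]; first by rewrite fw.
    exact: wm.
  by move=> /E -> /E ->.
(* The old lines are made to move in the prefix as well, so that all lines meet in the new focus. *)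
right; exists ((v ++ map Some u) :: [seq v ++ w | w <- ws]),
  (subst_line a0 v ++ u).
split; first by rewrite /= size_map sws.
split; first by rewrite size_cat size_map sv su.
- move=> w; rewrite inE => /orP[/eqP->|/mapP[w' w's ->]].
    rewrite size_cat size_map subst_cat subst_const sv su; split=> //.
    split; first by rewrite mem_cat vN.
    by move=> a b aS bS; rewrite !subst_cat !subst_const !(vE _ _ _ su).
  have [sw fw [wN wm]] := wsP _ w's.
  rewrite size_cat subst_cat fw sv sw; split=> //.
  split; first by rewrite mem_cat vN.
  move=> a b aS bS; rewrite !subst_cat !vE ?size_map //; exact: wm.
- rewrite /= subst_cat subst_const -map_comp.
  rewrite (eq_map (g := fun w => chi (subst_line a1 v ++ subst_line a1 w)))
    ?uN //.
  by move=> w /=; rewrite subst_cat.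
Qed.

Lemma hales_jewett_letters (T : finType) (s : seq T) (Q : finType) :
  exists L, forall chi : seq T -> Q,
    exists2 w, size w = L & mono_line s chi w.
Proof.
elim: s Q => [|a0 s IH] Q.
  by exists 1 => chi; exists [:: None].
case: s IH => [|a1 s] IH.
  exists 1 => chi; exists [:: None] => //; split=> // a b.
  by rewrite !inE => /eqP-> /eqP->.
(* [#|Q|.+1] focused lines would need more colours than there are. *)
have [L HL] := focusing_step Q a0 (mem_head a1 s) IH #|Q|.+1.
exists L => chi; case: (HL chi) => // -[ws [u [sws [_ _ /card_uniqP]]]].
rewrite size_map sws => cE; have := max_card [in [seq chi (subst_line a1 w) | w <- ws]].
by rewrite cE ltnn.
Qed.

Lemma hales_jewett (T Q : finType) :
  exists L, forall chi : seq T -> Q,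
    exists w, [/\ size w = L, None \in w &
      forall a b, chi (subst_line a w) = chi (subst_line b w)].
Proof.
have [L HL] := hales_jewett_letters (enum T) Q.
exists L => chi; have [w sw [wN wm]] := HL chi.
by exists w; split=> // a b; apply: wm; rewrite mem_enum.
Qed.

(** * Ramsey's theorem for subsequences *)

(** The colour of a subsequence of length [n.+1] depends only on its first entry, which carries this
    colour as second component. *)
Fixpoint end_homogeneous (X Q : eqType) (n : nat) (c : seq X -> Q)
    (zs : seq (X * Q)) : Prop :=
  if zs is z :: zs' then
    (forall t, subseq t (unzip1 zs') -> size t = n -> c (z.1 :: t) = z.2) /\
    end_homogeneous n c zs'
  else True.

Lemma end_homogeneous_filter (X Q : eqType) n (c : seq X -> Q) p zs :
  end_homogeneous n c zs -> end_homogeneous n c (filter p zs).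
Proof.
elim: zs => //= z zs IH [h /IH h']; case: ifP => //= _; split=> // t ts.
by apply: h; apply: subseq_trans ts _; apply: map_subseq; apply: filter_subseq.
Qed.

Lemma end_homogeneous_const (X Q : eqType) n (c : seq X -> Q) q zs :
  end_homogeneous n c zs -> all (fun z => z.2 == q) zs ->
  forall t, subseq t (unzip1 zs) -> size t = n.+1 -> c t = q.
Proof.
elim: zs => [_ _ [|//]//|z zs IH] /= [h hz] /andP[/eqP zq zsq] [//|x t] /=.
case: eqP => [-> ts [st]|_ ts st]; first by rewrite h.
exact: IH.
Qed.

Lemma pigeonhole_filter (X : Type) (Q : finType) (f : X -> Q) d (s : seq X) :
  #|Q| * d < size s -> exists q, d <= count (fun x => f x == q) s.
Proof.
move=> hs; apply/existsP; apply: contraLR hs.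
rewrite negb_exists -leqNgt => /forallP h.
have -> : size s = \sum_(q : Q) count (fun x => f x == q) s.
  elim: s {h} => [|x s IH] /=; first by rewrite big1.
  rewrite big_split /= -IH (bigD1 (f x)) //= eqxx big1 // => q.
  by rewrite eq_sym => /negPf->.
rewrite -sum_nat_const; apply: leq_sum => q _.
by apply: ltnW; rewrite ltnNge.
Qed.

(** The induction hypothesis first yields a long end-homogeneous sequence; the pigeonhole principle
    then picks [d] entries with the same recorded colour. *)
Lemma ramsey (X : eqType) (n : nat) (Q : finType) (d : nat) :
  exists N, forall (s : seq X) (c : seq X -> Q), N <= size s ->
    exists s', [/\ subseq s' s, size s' = d &
      forall t1 t2, subseq t1 s' -> subseq t2 s' ->
        size t1 = n -> size t2 = n -> c t1 = c t2].
Proof.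
elim: n Q d => [|n IH] Q d.
  exists d => s c ds; exists (take d s).
  by rewrite take_subseq size_takel //; split=> // -[|? ?] [|? ?].
have [N HN] : exists N, forall (s : seq X) (c : seq X -> Q), N <= size s ->
    exists zs, [/\ subseq (unzip1 zs) s, size zs = (#|Q| * d).+1 &
      end_homogeneous n c zs].
  elim: (_.+1) => [|M [N HN]].
    by exists 0 => s c _; exists [::]; rewrite sub0seq.
  (* The tail is thinned by the case [n] for the colouring [c (x :: t)], leaving [N] entries to
     continue with. *)
  have [N' HN'] := IH Q N.
  exists N'.+1 => -[//|x s] c /= sN.
  have [s1 [s1s ss1 hom]] := HN' s (fun t => c (x :: t)) sN.
  have [|zs [zss szs hz]] := HN s1 c; first by rewrite ss1.
  have [q hq] : exists q, forall t, subseq t s1 -> size t = n -> c (x :: t) = q.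
    exists (c (x :: take n s1)) => t ts st.
    have := size_subseq ts; rewrite st => ns.
    by apply: hom => //; rewrite ?take_subseq ?size_takel.
  exists ((x, q) :: zs); rewrite /= eqxx szs; split=> //.
    exact: subseq_trans zss s1s.
  split=> // t ts st; apply: hq => //; exact: subseq_trans ts zss.
exists N => s c /(HN s c) [zs [zss szs hz]].
have [|q hq] := @pigeonhole_filter _ _ (fun z : X * Q => z.2) d zs.
  by rewrite szs.
set ys := [seq z <- zs | z.2 == q].
exists (take d (unzip1 ys)); split.
- apply: subseq_trans (take_subseq _ _) _; apply: subseq_trans zss.
  by apply: map_subseq; apply: filter_subseq.
- by rewrite size_takel // size_map size_filter.
have hc t : subseq t (take d (unzip1 ys)) -> size t = n.+1 -> c t = q.
  move=> ts; apply: (end_homogeneous_const (zs := ys)).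
  - exact: end_homogeneous_filter.
  - exact: filter_all.
  - exact: subseq_trans ts (take_subseq _ _).
by move=> t1 t2 h1 h2 s1 s2; rewrite !hc.
Qed.

(** * The partite construction *)

Definition embedding (A C : Type) (EA : rel A) (EC : rel C) (f : A -> C) :=
  injective f /\ forall x y, EC (f x) (f y) = EA x y.

Lemma embedding_comp (A B C : Type) (EA : rel A) (EB : rel B) (EC : rel C)
    (g : B -> C) (f : A -> B) :
  embedding EB EC g -> embedding EA EB f -> embedding EA EC (g \o f).
Proof.
move=> [gi ge] [fi fe]; split; first exact: inj_comp.
by move=> x y /=; rewrite ge fe.
Qed.

Definition kfree (r : nat) (C : eqType) (E : rel C) :=
  forall s : seq C, uniq s -> {in s &, forall x y, x != y -> E x y} ->
  size s < r.

(** Irreflexivity makes [f] injective on [s], so the image of [s] is a clique of the same size. *)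
Lemma kfree_size_lt r (B C : eqType) (E : rel C) (f : B -> C) (s : seq B) :
  irreflexive E -> kfree r E -> uniq s ->
  {in s &, forall x y, x != y -> E (f x) (f y)} -> size s < r.
Proof.
move=> irr kf us hs; rewrite -(size_map f); apply: kf.
  rewrite map_inj_in_uniq // => x y xs ys fxy; apply/eqP.
  by apply: contraT => /(hs _ _ xs ys); rewrite fxy irr.
move=> _ _ /mapP[x xs ->] /mapP[y ys ->] nxy; apply: hs => //.
by apply: contraNneq nxy => ->.
Qed.

Section PartiteStep.
Variables (I : eqType) (A : finType) (EA : rel A) (e : A -> I).
Hypothesis e_inj : injective e.
Variables (P : finType) (EP : rel P) (p : P -> I).
Hypotheses (EP_irr : irreflexive EP) (EP_sym : symmetric EP).

(** Copies of [A] that meet the parts as prescribed by [e]; they are the alphabet for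
    Hales-Jewett. *)
Definition transversal (f : {ffun A -> P}) : bool :=
  [forall u, p (f u) == e u] && [forall u, forall v, EP (f u) (f v) == EA u v].

Definition letter := {f : {ffun A -> P} | transversal f}.

Lemma letter_proj (f : letter) u : p (val f u) = e u.
Proof. by case: f => f /= /andP[/forallP/(_ u)/eqP]. Qed.

Lemma letter_edge (f : letter) u v : EP (val f u) (val f v) = EA u v.
Proof. by case: f => f /= /andP[_ /forallP/(_ u)/forallP/(_ v)/eqP]. Qed.

Variable L : nat.

(** Over the parts [e u] the copies of [P] overlap inside the words of length [L]; over the other
    parts each line keeps a private copy. *)
Definition power := (L.-tuple (option letter) * P + A * L.-tuple P)%type.

Definition coordinate (x : P) (u : A) (o : option letter) : P :=
  if o is Some f then val f u else x.

Definition line_copy (w : L.-tuple (option letter)) (x : P) : power :=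
  if [pick u | e u == p x] is Some u then inr (u, map_tuple (coordinate x u) w)
  else inl (w, x).

(** The least edge relation for which every line with a moving coordinate gives a homomorphism from
    [P]. *)
Definition power_edge : rel power := fun a b =>
  [exists w : L.-tuple (option letter), exists x, exists y,
    [&& None \in w, a == line_copy w x, b == line_copy w y & EP x y]].

Definition power_proj (a : power) : I :=
  match a with inl wx => p wx.2 | inr ut => e ut.1 end.

Lemma power_edgeP a b :
  reflect (exists w x y, [/\ None \in w, a = line_copy w x, b = line_copy w y
                           & EP x y]) (power_edge a b).
Proof.
apply: (iffP existsP) => [[w /existsP[x /existsP[y]]]|[w [x [y [wN -> -> exy]]]]].
  by case/and4P=> wN /eqP-> /eqP-> exy; exists w, x, y.
by exists w; apply/existsP; exists x; apply/existsP; exists y; rewrite wN !eqxx.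
Qed.

Lemma power_inr_inj u t v t' : inr (u, t) = inr (v, t') :> power -> u = v /\ t = t'.
Proof. by case=> -> ->. Qed.

Variant line_copy_spec w x : power -> Type :=
| LineCopyOut of (forall u, e u <> p x) : line_copy_spec w x (inl (w, x))
| LineCopyIn u of e u = p x :
    line_copy_spec w x (inr (u, map_tuple (coordinate x u) w)).

Lemma line_copyP w x : line_copy_spec w x (line_copy w x).
Proof. by rewrite /line_copy; case: pickP => [u /eqP|n]; constructor=> // u /eqP; rewrite n. Qed.

Lemma line_copy_inl w x w' x' : line_copy w x = inl (w', x') -> w = w' /\ x = x'.
Proof. by case: line_copyP => // _ [-> ->]. Qed.

Lemma line_copy_inj (w : L.-tuple (option letter)) :
  None \in w -> injective (line_copy w).
Proof.
move=> /tnthP[j jN] x y; case: line_copyP => [_|u _]; case: line_copyP => [_|v _] //.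
  by case.
case/power_inr_inj=> _ /(congr1 (fun t => tnth t j)); rewrite !tnth_map -jN; exact.
Qed.

Lemma line_copy_proj w x : power_proj (line_copy w x) = p x.
Proof. by case: line_copyP. Qed.

(* At a moving coordinate of either line the pair is the original one, or the
   pair of two vertices of a transversal copy of A; the latter is an edge
   exactly when [EA] holds, which does not depend on the line. *)
Lemma line_copy_edge (w : L.-tuple (option letter)) x y :
  None \in w -> power_edge (line_copy w x) (line_copy w y) = EP x y.
Proof.
move=> wN; apply/power_edgeP/idP => [[w' [x' [y' [wN' ex ey exy']]]]|exy]; last first.
  by exists w, x, y.
have inl_case : w = w' -> EP x y.
  move=> ww'; subst w'.
  by rewrite (line_copy_inj wN ex) (line_copy_inj wN ey).
move: ex ey; case: (line_copyP w x) => [_|u eu].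
  by case/esym/line_copy_inl => /esym/inl_case.
case: (line_copyP w y) => [_ _|v ev].
  by case/esym/line_copy_inl => /esym/inl_case.
case: line_copyP => // _ _ /power_inr_inj[<- tu].
case: line_copyP => // _ _ /power_inr_inj[<- tv].
have cu j := congr1 (fun t => tnth t j) tu.
have cv j := congr1 (fun t => tnth t j) tv.
have [j jN] := tnthP _ _ wN; have [j' jN'] := tnthP _ _ wN'.
move: (cu j) (cv j) (cu j') (cv j'); rewrite !tnth_map -jN -jN' /=.
case: (tnth w' j) => [f|] /=; last by move=> -> ->.
case: (tnth w j') => [f'|] /=; last by move=> _ _ -> ->.
by move=> -> -> xe ye; rewrite letter_edge -(letter_edge f') xe ye.
Qed.

Lemma line_copy_embedding (w : L.-tuple (option letter)) :
  None \in w -> embedding EP power_edge (line_copy w).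
Proof.
move=> wN; split; first exact: line_copy_inj.
by move=> x y; apply: line_copy_edge.
Qed.

Lemma power_edge_sym : symmetric power_edge.
Proof.
by move=> a b; apply/power_edgeP/power_edgeP => -[w [x [y [wN ea eb exy]]]];
  exists w, y, x; rewrite EP_sym.
Qed.

Lemma power_edge_irr : irreflexive power_edge.
Proof.
move=> a; apply/negbTE/negP => /power_edgeP[w [x [y [wN -> h exy]]]].
by move: exy; rewrite (line_copy_inj wN h) EP_irr.
Qed.

Lemma power_edge_hom (R : rel I) :
  (forall x y, EP x y -> R (p x) (p y)) ->
  forall a b, power_edge a b -> R (power_proj a) (power_proj b).
Proof.
by move=> h a b /power_edgeP[w [x [y [_ -> -> /h]]]]; rewrite !line_copy_proj.
Qed.

(* A clique either leaves the parts over [e] and then lies in a single copy of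
   [P], or it lies over [e] and then projects to a clique of [A]. *)
Lemma power_kfree (R : rel I) r :
  irreflexive EA ->
  (forall x y, EP x y -> R (p x) (p y)) ->
  (forall u v, R (e u) (e v) = EA u v) ->
  kfree r EA -> kfree r EP -> kfree r power_edge.
Proof.
move=> EA_irr homP eR kA kP s us hs.
have [/hasP[[[w x]|//] xs _]|no_inl] :=
  boolP (has (fun a : power => if a is inl _ then true else false) s).
  pose ret a := odflt x [pick y | line_copy w y == a].
  apply: (kfree_size_lt (f := ret) EP_irr kP us) => a b sa sb nab.
  have inP c d : c \in s -> d \in s -> d != c -> None \in w /\ exists y, c = line_copy w y.
    move=> sc sd ndc.
    have [cE|nc] := eqVneq c (inl (w, x)).
      have := hs _ _ sd sc ndc.
      case/power_edgeP => w' [y [z [wN _ cz _]]].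
      have /line_copy_inl[ww' _] : line_copy w' z = inl (w, x) by rewrite -cz.
      by subst w'; split=> //; exists z.
    have := hs _ _ sc xs nc.
    case/power_edgeP => w' [y [z [wN cy cz _]]].
    by move/esym: cz => /line_copy_inl[ww' _]; subst w'; split=> //; exists y.
  have nba : b != a by rewrite eq_sym.
  have [wN [y ay]] := inP _ _ sa sb nba.
  have [_ [z bz]] := inP _ _ sb sa nab.
  have := hs _ _ sa sb nab; subst a b.
  have retK t : ret (line_copy w t) = t.
    rewrite /ret; case: pickP => [t' /eqP/(line_copy_inj wN) //|/(_ t)].
    by rewrite eqxx.
  by rewrite !retK line_copy_edge.
case: s us hs no_inl => [|a0 s] us hs no_inl.
  by have := kA [::]; apply.
case: a0 us hs no_inl => // -[u0 t0] us hs no_inl.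
pose part (a : power) := if a is inr ut then ut.1 else u0.
apply: (kfree_size_lt (f := part) EA_irr kA us) => a b sa sb nab.
have := power_edge_hom homP (hs _ _ sa sb nab).
move/hasPn: no_inl => no_inl.
move: (no_inl _ sa) (no_inl _ sb).
by case: a b {sa sb nab} => [//|[u t]] [//|[v t']] _ _ /=; rewrite eR.
Qed.

End PartiteStep.

(** A monochromatic line over the alphabet of transversal copies gives a copy of [P] all of whose
    transversal copies of [A] have one colour. *)
Lemma partite_step (I : eqType) (A : finType) (EA : rel A) (e : A -> I)
    (P : finType) (EP : rel P) (p : P -> I) (R : rel I) :
  injective e -> irreflexive EP -> symmetric EP ->
  (forall x y, EP x y -> R (p x) (p y)) ->
  exists (P' : finType) (EP' : rel P') (p' : P' -> I),
    [/\ irreflexive EP', symmetric EP',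
        forall x y, EP' x y -> R (p' x) (p' y),
        irreflexive EA -> (forall u v, R (e u) (e v) = EA u v) ->
          forall r, kfree r EA -> kfree r EP -> kfree r EP' &
        forall chi : {ffun A -> P'} -> bool,
        exists (h : P -> P') (c : bool),
          [/\ embedding EP EP' h, forall x, p' (h x) = p x &
            forall f : A -> P, (forall u, p (f u) = e u) -> embedding EA EP f ->
            chi [ffun u => h (f u)] = c]].
Proof.
move=> e_inj irr sym hom.
have [L HL] := hales_jewett (letter EA e EP p) bool.
exists (power EA e EP p L), (@power_edge _ _ EA e _ EP p L), (@power_proj _ _ EA e _ EP p L).
split; [exact: power_edge_irr|exact: power_edge_sym|exact: power_edge_hom| |].
  by move=> EA_irr eR r; apply: power_kfree eR.
move=> chi.
(* A word of transversal copies gives a map from [A], sending [u] to the word of their [u]-vertices;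
   a colouring of such maps thus colours words. *)
pose word_copy (t : L.-tuple (letter EA e EP p)) : {ffun A -> power EA e EP p L} :=
  [ffun u => inr (u, map_tuple (fun f : letter EA e EP p => val f u) t)].
have [w [sw wN wm]] :=
  HL (fun t => if insub t is Some t' then chi (word_copy t') else false).
pose wt := tcast sw (in_tuple w).
have wtE : wt = w :> seq _ by rewrite val_tcast.
pose line_color f := if insub (subst_line f w) is Some t' then chi (word_copy t') else false.
have lineE (f : letter EA e EP p) : line_color f = chi [ffun u => line_copy wt (val f u)].
  rewrite /line_color insubT ?size_map ?sw // => sf; congr (chi _); apply/ffunP => u.
  rewrite !ffunE; case: line_copyP => [/(_ u)|v].
    by rewrite letter_proj.
  rewrite letter_proj => /e_inj->; congr (inr (_, _)); apply: val_inj => /=.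
  by rewrite wtE -map_comp; apply: eq_map => -[].
have wN' : None \in wt by rewrite -[_ \in _]/(None \in (wt : seq _)) wtE.
(* Without letters there is no transversal copy to colour, and the default is arbitrary. *)
exists (line_copy wt), (if [pick f : letter EA e EP p] is Some f then line_color f else true).
split; [exact: line_copy_embedding|exact: line_copy_proj|move=> f fp [_ fE]].
have tf : transversal EA e EP p (finfun f).
  apply/andP; split; first by apply/forallP => u; rewrite ffunE fp.
  by apply/forallP => u; apply/forallP => v; rewrite !ffunE fE.
pose lf : letter EA e EP p := exist (fun f => transversal EA e EP p f) _ tf.
case: pickP => [f0 _|/(_ lf) //].
transitivity (line_color lf); last exact: wm.
by rewrite lineE; congr (chi _); apply/ffunP => u; rewrite !ffunE /= ?ffunE.
Qed.

(** One partite step is made for each projection in [es]; afterwards the colour of a copy depends on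
    its projection alone. *)
Lemma partite_construction (I : finType) (A : finType) (EA : rel A)
    (es : seq {ffun A -> I}) (P : finType) (EP : rel P) (p : P -> I) (R : rel I) :
  (forall e : {ffun A -> I}, e \in es -> injective e) ->
  irreflexive EP -> symmetric EP ->
  (forall x y, EP x y -> R (p x) (p y)) ->
  exists (P' : finType) (EP' : rel P'),
    [/\ irreflexive EP', symmetric EP',
        irreflexive EA ->
          (forall e : {ffun A -> I}, e \in es -> forall u v, R (e u) (e v) = EA u v) ->
          forall r, kfree r EA -> kfree r EP -> kfree r EP' &
        forall chi : {ffun A -> P'} -> bool,
        exists (h : P -> P') (c : {ffun A -> I} -> bool),
          embedding EP EP' h /\
          forall f : A -> P, embedding EA EP f -> [ffun u => p (f u)] \in es ->
            chi [ffun u => h (f u)] = c [ffun u => p (f u)]].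
Proof.
elim: es P EP p => [|e es IH] P EP p e_inj irr sym hom.
  exists P, EP; split=> // chi; exists id, (fun _ => true).
  by split=> [|f _ //]; split.
have ei : injective e by apply: e_inj; rewrite mem_head.
have [P1 [EP1 [p1 [irr1 sym1 hom1 kf1 col1]]]] := partite_step EA ei irr sym hom.
have [|P' [EP' [irr' sym' kf' col']]] := IH P1 EP1 p1 _ irr1 sym1 hom1.
  by move=> e' e'es; apply: e_inj; rewrite inE e'es orbT.
exists P', EP'; split=> //.
  move=> EA_irr eR r kA kP; apply: kf' => //.
    by move=> e' e'es; apply: eR; rewrite inE e'es orbT.
  by apply: kf1 => //; apply: eR; rewrite mem_head.
(* A copy of [P1] good for [es] comes first, then a copy of [P] inside it that is good for [e]; [h0]
   preserves projections, so the first property survives. *)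
move=> chi; have [h1 [c1 [emb1 mono1]]] := col' chi.
have [h0 [c0 [emb0 ph0 mono0]]] := col1 (fun f => chi [ffun u => h1 (f u)]).
exists (h1 \o h0), (fun e' => if e' == e then c0 else c1 e').
split; first exact: embedding_comp emb1 emb0.
move=> f femb; rewrite inE; case: eqP => [fe _|_ /= fes].
  rewrite -(mono0 f) //; last by move=> u; rewrite -fe ffunE.
  by congr (chi _); apply/ffunP => u; rewrite !ffunE.
have E : [ffun u => p1 ((h0 \o f) u)] = [ffun u => p (f u)].
  by apply/ffunP => u; rewrite !ffunE /= ph0.
by rewrite -E -(mono1 (h0 \o f)) ?E //; apply: embedding_comp femb.
Qed.

(** * The Ramsey theorem for ordered K_r-free graphs *)

Definition order_type (A : finType) (f : A -> nat) : {ffun A * A -> bool} :=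
  [ffun uv => f uv.1 < f uv.2].

Lemma size_filter_codom (A : finType) (f : A -> nat) (x : nat) :
  injective f ->
  size [seq i <- iota 0 x | i \in codom f] = #|[pred v | f v < x]|.
Proof.
move=> fi; rewrite cardE -(size_map f); apply: perm_size; apply: uniq_perm.
- by rewrite filter_uniq ?iota_uniq.
- by rewrite map_inj_uniq ?enum_uniq.
move=> y; rewrite mem_filter mem_iota /= add0n.
apply/andP/mapP => [[/codomP[v ->] yx]|[v]]; first by exists v; rewrite ?mem_enum.
by rewrite mem_enum inE => vx ->; rewrite codom_f.
Qed.

Lemma index_filter_codom (A : finType) (f : A -> nat) (d : nat) (u : A) :
  injective f -> f u < d ->
  index (f u) [seq i <- iota 0 d | i \in codom f] = #|[pred v | f v < f u]|.
Proof.
move=> fi fud; rewrite -(subnKC (ltnW fud)) iotaD filter_cat index_cat.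
rewrite mem_filter mem_iota add0n ltnn andbF size_filter_codom //.
have fuf : f u \in codom f by exact: codom_f.
by rewrite -[d - f u]prednK ?subn_gt0 //= fuf /= eqxx addn0.
Qed.

(** An injection is determined by its set of values and their ranks. Ramsey's theorem is applied to
    [c'], which records the colours of all arrangements of [A] along an increasing sequence. *)
Lemma ordered_ramsey (A : finType) (d : nat) :
  exists N, forall c : {ffun A -> 'I_N} -> bool,
  exists g : 'I_d -> 'I_N, injective g /\
    forall f1 f2 : A -> 'I_d, injective f1 -> injective f2 ->
    order_type f1 = order_type f2 ->
    c [ffun u => g (f1 u)] = c [ffun u => g (f2 u)].
Proof.
pose n := #|A|.
have [N HN] := ramsey nat n {ffun {ffun A -> 'I_n.+1} -> bool} d.
exists N.+1 => c.
pose c' (t : seq nat) :=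
  [ffun q : {ffun A -> 'I_n.+1} => c [ffun u => inord (nth 0 t (q u))]].
have [s [ss sd hom]] := HN (iota 0 N) c' (eq_leq (esym (size_iota 0 N))).
have us : uniq s by apply: subseq_uniq ss (iota_uniq _ _).
have sN i : i < d -> nth 0 s i < N.+1.
  move=> id; have := mem_subseq ss (mem_nth 0 (_ : i < size s)).
  by rewrite sd mem_iota => /(_ id) /andP[_]; rewrite add0n => /ltnW.
exists (fun x => inord (nth 0 s x)); split.
  move=> x y /(congr1 val); rewrite /= !inordK ?sN // => /eqP.
  by rewrite nth_uniq ?sd // => /eqP/val_inj.
pose tr (f : A -> 'I_d) := [seq nth 0 s i | i <- [seq i <- iota 0 d | i \in codom (val \o f)]].
pose rk (f : A -> 'I_d) : {ffun A -> 'I_n.+1} := [ffun u => inord #|[pred v | f v < f u]|].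
have trP f : injective f -> subseq (tr f) s /\ size (tr f) = n.
  move=> fi; split.
    rewrite -[X in subseq _ X](mkseq_nth 0) sd; apply: map_subseq.
    exact: filter_subseq.
  rewrite size_map size_filter_codom; last exact: inj_comp val_inj fi.
  by apply: eq_card => v; rewrite !inE /= ltn_ord.
have trE (f : A -> 'I_d) : injective f -> c [ffun u => inord (nth 0 s (f u))] = c' (tr f) (rk f).
  move=> fi; rewrite ffunE; congr (c _); apply/ffunP => u; rewrite !ffunE.
  rewrite inordK; last by rewrite ltnS max_card.
  have vfi : injective (val \o f) by exact: inj_comp val_inj fi.
  have fud : (val \o f) u < d by exact: ltn_ord.
  have /= <- := index_filter_codom vfi fud.
  have fin : val (f u) \in [seq i <- iota 0 d | i \in codom (val \o f)].
    by rewrite mem_filter mem_iota /= ltn_ord andbT (codom_f (val \o f)).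
  by rewrite (nth_map 0) ?index_mem // nth_index.
move=> f1 f2 i1 i2 ot12; rewrite !trE //.
have [t1 s1] := trP _ i1; have [t2 s2] := trP _ i2.
rewrite (hom _ _ t1 t2 s1 s2); congr (c' _ _); apply/ffunP => u; rewrite !ffunE.
congr inord; apply: eq_card => v; rewrite !inE.
by have /ffunP/(_ (v, u)) := ot12; rewrite !ffunE.
Qed.

(** The initial partite system is a disjoint union of copies of [ED], one for each [g] in [ok], with
    [x] in the part [g x]. As [c] is found before [g], a Ramsey property of the base can choose [g]
    to suit [c]. *)
Lemma partite_lift (I A : finType) (EA : rel A) (d : nat) (ED : rel 'I_d)
    (R : rel I) (ok : pred {ffun 'I_d -> I}) (es : seq {ffun A -> I}) :
  irreflexive ED -> symmetric ED ->
  (forall e : {ffun A -> I}, e \in es -> injective e) ->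
  (forall g, ok g -> forall x y, ED x y -> R (g x) (g y)) ->
  exists (C : finType) (EC : rel C),
    [/\ irreflexive EC, symmetric EC,
        irreflexive EA ->
          (forall e : {ffun A -> I}, e \in es -> forall u v, R (e u) (e v) = EA u v) ->
          forall r, kfree r EA -> kfree r ED -> kfree r EC &
        forall chi : {ffun A -> C} -> bool,
        exists c : {ffun A -> I} -> bool, forall g, ok g ->
        exists h : 'I_d -> C, embedding ED EC h /\
          forall f : A -> 'I_d, embedding EA ED f -> [ffun u => g (f u)] \in es ->
            chi [ffun u => h (f u)] = c [ffun u => g (f u)]].
Proof.
move=> irr sym e_inj okR.
pose P := ({ffun 'I_d -> I} * 'I_d)%type.
pose EP : rel P := fun a b => [&& a.1 == b.1, ok a.1 & ED a.2 b.2].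
pose p (a : P) := a.1 a.2.
have EP_irr : irreflexive EP by move=> a; rewrite /EP irr !andbF.
have EP_sym : symmetric EP.
  by move=> a b; rewrite /EP eq_sym sym; case: eqP => [->|].
have EP_hom a b : EP a b -> R (p a) (p b).
  by case: a b => [g x] [g' y] /and3P[/= /eqP<- okg]; apply: okR.
have [C [EC [irrC symC kfC colC]]] := partite_construction EA e_inj EP_irr EP_sym EP_hom.
exists C, EC; split=> //.
  move=> EA_irr eR r kA kD; apply: kfC => // s us hs.
  apply: (kfree_size_lt (f := snd) irr kD us) => a b sa sb nab.
  by have /and3P[] := hs _ _ sa sb nab.
move=> chi; have [h [c [hemb hc]]] := colC chi.
exists c => g okg.
have gemb : embedding ED EP (pair g).
  by split=> [x y [] //|x y]; rewrite /EP /= eqxx okg.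
exists (h \o pair g); split; first exact: embedding_comp hemb gemb.
move=> f femb fes; have := hc (pair g \o f) (embedding_comp gemb femb) fes.
by [].
Qed.

(** The base is ['I_N] with all pairs allowed as edges, and [ordered_ramsey] for the colouring [c]
    selects the injection [g]. *)
Lemma graph_ramsey (A : finType) (EA : rel A) (d : nat) (ED : rel 'I_d) :
  irreflexive ED -> symmetric ED ->
  exists (C : finType) (EC : rel C),
    [/\ irreflexive EC, symmetric EC &
        forall chi : {ffun A -> C} -> bool,
        exists h : 'I_d -> C, embedding ED EC h /\
          forall f1 f2 : A -> 'I_d, embedding EA ED f1 -> embedding EA ED f2 ->
            order_type f1 = order_type f2 ->
            chi [ffun u => h (f1 u)] = chi [ffun u => h (f2 u)]].
Proof.
move=> irr sym; have [N HN] := ordered_ramsey A d.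
have [e|//|C [EC [irrC symC _ colC]]] := @partite_lift 'I_N A EA d ED
  (fun _ _ => true) xpredT (enum [pred e : {ffun A -> 'I_N} | injectiveb e]) irr sym.
  by rewrite mem_enum inE => /injectiveP.
exists C, EC; split=> // chi.
have [c hc] := colC chi; have [g [gi gc]] := HN c.
have [h [hemb hh]] := hc (finfun g) isT.
exists h; split=> // f1 f2 emb1 emb2 ot12.
have E f : embedding EA ED f ->
    chi [ffun u => h (f u)] = c [ffun u => g (f u)].
  move=> femb.
  have fE : [ffun u => finfun g (f u)] = [ffun u => g (f u)].
    by apply/ffunP => u; rewrite !ffunE.
  rewrite hh ?fE // mem_enum inE; apply/injectiveP => u v.
  by rewrite !ffunE => /gi/(proj1 femb).
by rewrite !E //; apply: gc ot12; [case: emb1|case: emb2].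
Qed.

Definition embeddingb (A : finType) (C : eqType) (EA : rel A) (EC : rel C)
    (f : {ffun A -> C}) : bool :=
  injectiveb f && [forall x, forall y, EC (f x) (f y) == EA x y].

Lemma embeddingP (A : finType) (C : eqType) (EA : rel A) (EC : rel C)
    (f : {ffun A -> C}) :
  reflect (embedding EA EC f) (embeddingb EA EC f).
Proof.
apply: (iffP andP) => -[fi fE]; split.
- exact/injectiveP.
- by move=> x y; have /forallP/(_ x)/forallP/(_ y)/eqP := fE.
- exact/injectiveP.
- by apply/forallP => x; apply/forallP => y; rewrite fE.
Qed.

(* The base of the second partite construction is a Ramsey graph that may
   contain large cliques; since only copies of A in it are used, the
   construction over it stays K_r-free. *)
Lemma kfree_graph_ramsey (r : nat) (A : finType) (EA : rel A) (d : nat) (ED : rel 'I_d) :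
  irreflexive EA -> kfree r EA ->
  irreflexive ED -> symmetric ED -> kfree r ED ->
  exists (C : finType) (EC : rel C),
    [/\ irreflexive EC, symmetric EC, kfree r EC &
        forall chi : {ffun A -> C} -> bool,
        exists h : 'I_d -> C, embedding ED EC h /\
          forall f1 f2 : A -> 'I_d, embedding EA ED f1 -> embedding EA ED f2 ->
            order_type f1 = order_type f2 ->
            chi [ffun u => h (f1 u)] = chi [ffun u => h (f2 u)]].
Proof.
move=> irrA kA irr sym kD.
have [C0 [E0 [irr0 sym0 col0]]] := graph_ramsey EA irr sym.
pose ok (g : {ffun 'I_d -> C0}) := embeddingb ED E0 g.
pose good (e : {ffun A -> C0}) := embeddingb EA E0 e.
have [e|g|C [EC [irrC symC kfC colC]]] := @partite_lift C0 A EA d ED E0 ok (enum good) irr sym.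
- by rewrite mem_enum => /embeddingP[].
- by move=> /embeddingP[_ gE] x y; rewrite gE.
exists C, EC; split=> //.
  by apply: kfC => // e; rewrite mem_enum => /embeddingP[].
move=> chi; have [c hc] := colC chi; have [g [gemb gc]] := col0 c.
have okg : ok (finfun g).
  apply/embeddingP; split=> x y; first by rewrite !ffunE => /(proj1 gemb).
  by rewrite !ffunE (proj2 gemb).
have [h [hemb hh]] := hc _ okg.
exists h; split=> // f1 f2 emb1 emb2 ot12.
have E f : embedding EA ED f ->
    chi [ffun u => h (f u)] = c [ffun u => g (f u)].
  move=> femb.
  have fE : [ffun u => finfun g (f u)] = [ffun u => g (f u)].
    by apply/ffunP => u; rewrite !ffunE.
  rewrite hh ?fE // mem_enum; apply/embeddingP; have [gi gE] := embedding_comp gemb femb.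
  by split=> u v; rewrite !ffunE; [exact: gi|exact: gE].
by rewrite !E //; apply: gc ot12.
Qed.

(** * Universality and homogeneity of the random K_r-free graph *)

Definition partial_iso (C D : eqType) (EC : rel C) (ED : rel D) (l : seq (C * D)) :=
  all (fun a => all (fun b =>
    ((a.1 == b.1) == (a.2 == b.2)) && (EC a.1 b.1 == ED a.2 b.2)) l) l.

Lemma partial_isoP (C D : eqType) (EC : rel C) (ED : rel D) (l : seq (C * D)) :
  reflect {in l &, forall a b,
             (a.1 == b.1) = (a.2 == b.2) /\ EC a.1 b.1 = ED a.2 b.2}
          (partial_iso EC ED l).
Proof.
apply: (iffP allP) => [h a b al bl|h a al].
  by have /allP/(_ b bl)/andP[/eqP-> /eqP->] := h a al.
by apply/allP => b bl; have [-> ->] := h a b al bl; rewrite !eqxx.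
Qed.

Lemma partial_iso_subset (C D : eqType) (EC : rel C) (ED : rel D)
    (l l' : seq (C * D)) :
  {subset l' <= l} -> partial_iso EC ED l -> partial_iso EC ED l'.
Proof.
by move=> sub /partial_isoP h; apply/partial_isoP => a b /sub al /sub; apply: h.
Qed.

Definition swap (X Y : Type) (a : X * Y) : Y * X := (a.2, a.1).

Lemma partial_iso_swap (C D : eqType) (EC : rel C) (ED : rel D) (l : seq (C * D)) :
  partial_iso ED EC (map (@swap C D) l) = partial_iso EC ED l.
Proof.
apply/partial_isoP/partial_isoP => h.
  by move=> a b al bl; have [] := h _ _ (map_f (@swap _ _) al) (map_f (@swap _ _) bl).
by move=> _ _ /mapP[a al ->] /mapP[b bl ->]; have [] := h _ _ al bl.
Qed.

Definition lookup (X Y : eqType) (y0 : Y) (l : seq (X * Y)) (x : X) : Y :=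
  nth y0 (unzip2 l) (index x (unzip1 l)).

Lemma mem_lookup (X Y : eqType) (y0 : Y) (l : seq (X * Y)) (x : X) :
  x \in unzip1 l -> (x, lookup y0 l x) \in l.
Proof.
rewrite /lookup; elim: l => //= -[a b] l IH; rewrite !inE /= eq_sym.
case: eqVneq => [->|_] /=; first by rewrite eqxx.
by move/IH => ->; rewrite orbT.
Qed.

Section Henson.
Variables (E : rel nat) (r : nat).
Hypothesis HE : random_Kr_free_graph E r.

Lemma henson_irr : irreflexive E. Proof. by case: HE. Qed.
Lemma henson_sym : symmetric E. Proof. by case: HE. Qed.

Lemma henson_kfree : kfree r E.
Proof.
case: HE => _ _ cl _ s us hs; apply: cl; rewrite /clique us /=.
elim: s us hs => //= x s IH /andP[xs us] hs; apply/andP; split.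
  apply/allP => y ys; apply: hs; rewrite ?mem_head ?inE ?ys ?orbT //.
  by apply: contraNneq xs => ->.
by apply: IH => // y z ys zs; apply: hs; rewrite inE ?ys ?zs orbT.
Qed.

Lemma clique_adj (s : seq nat) :
  clique E s -> {in s &, forall x y, x != y -> E x y}.
Proof.
case/andP=> _; elim: s => //= x s IH /andP[/allP xs /IH {}IH] y z.
rewrite !inE => /orP[/eqP->|ys] /orP[/eqP->|zs]; rewrite ?eqxx // => nyz.
- exact: xs.
- by rewrite henson_sym xs.
- exact: IH.
Qed.

(** [U] and [V] are the images of the neighbours and non-neighbours of [x]. A clique in [U] pulls
    back and forms a clique of [C] together with [x], so it has fewer than [r.-1] vertices. *)
Lemma one_point_extension (C : eqType) (EC : rel C) (l : seq (C * nat)) (x : C) :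
  irreflexive EC -> symmetric EC -> kfree r EC -> partial_iso EC E l ->
  exists y, partial_iso EC E ((x, y) :: l).
Proof.
move=> irr sym kC iso; have /partial_isoP isoE := iso.
have [/(mem_lookup 0) xl|xl] := boolP (x \in unzip1 l).
  exists (lookup 0 l x); apply: partial_iso_subset iso => a.
  by rewrite inE => /orP[/eqP->|].
have ndom a : a \in l -> x != a.1.
  by move=> al; apply: contraNneq xl => ->; apply: map_f.
pose U := [seq a.2 | a <- l & EC x a.1].
pose V := [seq a.2 | a <- l & ~~ EC x a.1].
case: HE => _ _ _ /(_ U V)[|t tU ct|z [zU zV aU aV]].
- apply/allP => _ /mapP[a + ->]; rewrite mem_filter => /andP[xa al].
  apply/mapP => -[b]; rewrite mem_filter => /andP[xb bl] /eqP.
  by rewrite -(proj1 (isoE _ _ al bl)) => /eqP ab; move: xb; rewrite -ab xa.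
- pose inv n := lookup x (map (@swap _ _) l) n.
  have invP n : n \in t -> (inv n, n) \in l /\ EC x (inv n).
    move=> nt; have /mapP[a + nE] := tU _ nt.
    rewrite mem_filter => /andP[xa al].
    have : (n, inv n) \in map (@swap _ _) l.
      by apply: mem_lookup; rewrite nE; exact: (map_f fst (map_f (@swap _ _) al)).
    case/mapP => b bl /= [nb ib]; have -> : (inv n, n) = b by rewrite ib {1}nb -surjective_pairing.
    split=> //; have /eqP : b.2 == a.2 by rewrite -nb nE.
    by move/eqP; rewrite -(proj1 (isoE _ _ bl al)) ib => /eqP->.
  have inv_inj : {in t &, injective inv}.
    move=> m n /invP[ml _] /invP[nl _] /eqP.
    by have [/= -> _] := isoE _ _ ml nl => /eqP.
  have : size (x :: map inv t) < r.
    apply: kC => /=.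
      rewrite map_inj_in_uniq //; case/andP: (ct) => -> _; rewrite andbT.
      by apply/mapP => -[n /invP[_ +] xE]; rewrite -xE irr.
    have xadj n : n \in t -> EC x (inv n) by case/invP.
    move=> a b; rewrite !inE => /orP[/eqP->|/mapP[m mt ->]] /orP[/eqP->|/mapP[n nt ->]].
    + by rewrite eqxx.
    + by rewrite xadj.
    + by rewrite sym xadj.
    + have [[ml _] [nl _]] := (invP _ mt, invP _ nt).
      have [/= -> ->] := isoE _ _ ml nl; exact: (clique_adj ct).
  by rewrite /= size_map; case: (r).
exists z; have zE a : a \in l -> (z != a.2) && (E z a.2 == EC x a.1).
  move=> al; have [xa|xa] := boolP (EC x a.1).
    have aU' : a.2 \in U by apply: map_f; rewrite mem_filter xa.
    rewrite (allP aU _ aU') andbT; by apply: contraNneq zU => ->.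
  have aV' : a.2 \in V by apply: map_f; rewrite mem_filter xa.
  rewrite (negbTE (allP aV _ aV')) andbT; by apply: contraNneq zV => ->.
apply/partial_isoP => a b; rewrite !inE => /orP[/eqP->|al] /orP[/eqP->|bl].
- by rewrite /= !eqxx irr henson_irr.
- have /andP[/= /negPf-> /eqP->] := zE _ bl.
  by rewrite (negPf (ndom _ bl)).
- have /andP[/= nz /eqP ez] := zE _ al.
  by rewrite [_ == x]eq_sym [_ == z]eq_sym sym henson_sym ez (negPf nz) (negPf (ndom _ al)).
- exact: isoE.
Qed.

Lemma henson_universal (C : finType) (EC : rel C) :
  irreflexive EC -> symmetric EC -> kfree r EC ->
  exists i : C -> nat, embedding EC E i.
Proof.
move=> irr sym kC.
have [l dom /partial_isoP iso] : exists2 l, {subset enum C <= unzip1 l} & partial_iso EC E l.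
  elim: (enum C) => [|x s [l dom iso]]; first by exists [::].
  have [y iso'] := one_point_extension x irr sym kC iso.
  exists ((x, y) :: l) => // z; rewrite !inE => /orP[->//|/dom ->].
  by rewrite orbT.
have lk x : (x, lookup 0 l x) \in l by apply/mem_lookup/dom; rewrite mem_enum.
exists (lookup 0 l); split=> x y.
  by move=> /eqP; have [/= <- _] := iso _ _ (lk x) (lk y) => /eqP.
by have [/= _ <-] := iso _ _ (lk x) (lk y).
Qed.

Definition piso := {l : seq (nat * nat) | partial_iso E E l}.

Lemma forth_ex (L : piso) (x : nat) : exists y, partial_iso E E ((x, y) :: val L).
Proof.
by apply: one_point_extension; [exact: henson_irr|exact: henson_sym|
  exact: henson_kfree|exact: valP].
Qed.

Lemma back_ex (L : piso) (y : nat) : exists x, partial_iso E E ((x, y) :: val L).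
Proof.
have [||||x] := @one_point_extension _ E (map (@swap _ _) (val L)) y.
- exact: henson_irr.
- exact: henson_sym.
- exact: henson_kfree.
- by rewrite partial_iso_swap; apply: valP.
by rewrite -[_ :: _]/(map (@swap _ _) ((x, y) :: val L)) partial_iso_swap; exists x.
Qed.

Definition forth (L : piso) (x : nat) : piso :=
  exist (fun l => partial_iso E E l) _ (xchooseP (forth_ex L x)).
Definition back (L : piso) (y : nat) : piso :=
  exist (fun l => partial_iso E E l) _ (xchooseP (back_ex L y)).

Fixpoint back_and_forth (L : piso) (n : nat) : piso :=
  if n is m.+1 then back (forth (back_and_forth L m) m) m else L.

Lemma back_and_forth_mono L m n :
  m <= n -> {subset val (back_and_forth L m) <= val (back_and_forth L n)}.
Proof.
move=> mn a; rewrite -(subnK mn); elim: (n - m) => //= k IH /IH h.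
by rewrite !inE h !orbT.
Qed.

(** Stage [m.+1] of the back-and-forth has [m] in its domain and in its range, so the union of the
    stages is the graph of an automorphism. *)
Lemma henson_homogeneous (l : seq (nat * nat)) :
  partial_iso E E l -> exists g : aut E, forall a, a \in l -> g a.1 = a.2.
Proof.
move=> isol; pose ch := back_and_forth (exist _ l isol).
have iso m n a b : a \in val (ch m) -> b \in val (ch n) ->
    (a.1 == b.1) = (a.2 == b.2) /\ E a.1 b.1 = E a.2 b.2.
  move=> am bn; have /partial_isoP := valP (ch (maxn m n)); apply.
    exact: back_and_forth_mono (leq_maxl m n) _ am.
  exact: back_and_forth_mono (leq_maxr m n) _ bn.
pose g x := lookup 0 (val (ch x.+1)) x.
pose g' y := lookup 0 (map (@swap _ _) (val (ch y.+1))) y.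
have gP x : (x, g x) \in val (ch x.+1).
  by apply: mem_lookup; rewrite /= !inE eqxx /= orbT.
have g'P y : (g' y, y) \in val (ch y.+1).
  have : (y, g' y) \in map (@swap _ _) (val (ch y.+1)).
    by apply: mem_lookup; rewrite /= inE eqxx.
  by case/mapP => -[a b] h [yb gy]; rewrite gy {1}yb.
have gK : cancel g g'.
  by move=> x; apply/eqP; have [/= -> _] := iso _ _ _ _ (g'P (g x)) (gP x).
have g'K : cancel g' g.
  by move=> y; apply/eqP; have [/= <- _] := iso _ _ _ _ (gP (g' y)) (g'P y).
have gE x y : E (g x) (g y) = E x y by have [/= _ ->] := iso _ _ _ _ (gP x) (gP y).
exists (Aut (Bijective gK g'K) gE) => a al /=.
apply/eqP; have al0 : a \in val (ch 0) by [].
by have [/= <- _] := iso _ _ _ _ (gP a.1) al0.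
Qed.

End Henson.

(** * Minimal sets are determined by order types *)

Section Minimal.
Variables (E : rel nat) (r : nat) (A : {fset nat}).
Hypothesis HE : random_Kr_free_graph E r.

Definition induced : rel A := fun x y => E (val x) (val y).

Lemma Emb_embedding (s : Emb E A) : embedding induced E (val s).
Proof. exact/embeddingP/(valP s). Qed.

Lemma induced_irr : irreflexive induced.
Proof. by move=> x; apply: henson_irr HE _. Qed.

Lemma induced_kfree : kfree r induced.
Proof.
by move=> s us hs; apply: (kfree_size_lt (f := val) (henson_irr HE) (henson_kfree HE) us).
Qed.

(** [S] colours the copies of [A] in a Ramsey graph for the first [d] vertices, embedded by
    universality. Homogeneity then extends the passage to the good copy of these vertices to an
    automorphism. *)
Lemma order_pattern (S : Emb E A -> bool) (d : nat) :
  exists (X : {ffun {ffun A * A -> bool} -> bool}) (g : aut E),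
  forall s : Emb E A, (forall x, val s x < d) ->
    S (comp_emb g s) = X (order_type (val s)).
Proof.
pose ED : rel 'I_d := fun x y => E x y.
have ED_irr : irreflexive ED by move=> x; apply: henson_irr HE _.
have ED_sym : symmetric ED by move=> x y; apply: henson_sym HE _ _.
have ED_kfree : kfree r ED.
  by move=> s us hs; apply: (kfree_size_lt (f := val) (henson_irr HE) (henson_kfree HE) us).
have [C [EC [irrC symC kC colC]]] :=
  kfree_graph_ramsey induced_irr induced_kfree ED_irr ED_sym ED_kfree.
have [i iemb] := henson_universal HE irrC symC kC.
pose chi (f : {ffun A -> C}) : bool :=
  if insub [ffun u => i (f u)] is Some s then S s else false.
have [h [hemb hmono]] := colC chi.
have [ihi ihE] := embedding_comp iemb hemb.
have [g gE] : exists g : aut E, forall a, a \in [seq (val x, i (h x)) | x <- enum 'I_d] -> g a.1 = a.2.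
  apply: (henson_homogeneous HE); apply/partial_isoP.
  move=> _ _ /mapP[x _ ->] /mapP[y _ ->] /=; split; last by rewrite (ihE x y).
  by apply/eqP/eqP => [/val_inj->|/ihi->].
(* The value at [o] is the common colour of the copies of order type [o], and [false] if there are
   none. *)
exists [ffun o => [exists f : {ffun A -> 'I_d},
  [&& embeddingb induced ED f, order_type (fun x => f x : nat) == o & chi [ffun u => h (f u)]]]], g.
move=> s sd; pose f := [ffun u => Ordinal (sd u)] : {ffun A -> 'I_d}.
have [si sE] := Emb_embedding s.
have femb : embedding induced ED f.
  by split=> x y; rewrite !ffunE /ED /= ?sE // => -[/si].
have fE : order_type (fun x => f x : nat) = order_type (val s).
  by apply/ffunP => u; rewrite !ffunE.
have chiE : S (comp_emb g s) = chi [ffun u => h (f u)].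
  have E1 : [ffun u => i ([ffun u => h (f u)] u)] = val (comp_emb g s).
    apply/ffunP => u; rewrite !ffunE.
    by rewrite (gE (_, _) (map_f _ (mem_enum _ (Ordinal (sd u))))).
  by rewrite /chi E1 valK.
rewrite chiE ffunE; apply/idP/existsP => [chf|[f' /and3P[/embeddingP emb' /eqP ot' chf']]].
  by exists f; rewrite chf fE eqxx; apply/and3P; split=> //; apply/embeddingP.
by rewrite (hmono f f') // fE ot'.
Qed.

(** There are finitely many patterns [X]. If each failed for some [d], all would fail at the largest
    of these, against [order_pattern]. *)
Lemma order_limit (S : Emb E A -> bool) :
  exists X : {ffun {ffun A * A -> bool} -> bool}, forall d, exists g : aut E,
  forall s : Emb E A, (forall x, val s x < d) ->
    S (comp_emb g s) = X (order_type (val s)).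
Proof.
apply: NNPP => noX.
pose good X d := exists g : aut E, forall s : Emb E A, (forall x, val s x < d) ->
    S (comp_emb g s) = X (order_type (val s)).
have [d bad] : exists d, forall X, X \in enum {ffun {ffun A * A -> bool} -> bool} -> ~ good X d.
  elim: (enum _) => [|X Xs [d IH]]; first by exists 0.
  have [d' badX] : exists d', ~ good X d'.
    apply: NNPP => h; apply: noX; exists X => d'; apply: NNPP => badX.
    by apply: h; exists d'.
  exists (maxn d d') => Y; rewrite inE => /orP[/eqP->|/IH badY] [g hg].
    apply: badX; exists g => s sd; apply: hg => x.
    by rewrite leq_max sd orbT.
  by apply: badY; exists g => s sd; apply: hg => x; rewrite leq_max sd.
have [X hX] := order_pattern S d.
by apply: (bad X); rewrite ?mem_enum.
Qed.

(** The set defined by [X] and the order of nat lies in the orbit closure of [S], so by minimality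
    [S] lies in the orbit closure of that set. The automorphisms witnessing this serve as [rho]. *)
Lemma minimal_order_type (S : Emb E A -> bool) : minimal_set S ->
  exists X : {ffun {ffun A * A -> bool} -> bool}, forall F : seq (Emb E A),
  exists rho : nat -> nat, forall f, f \in F ->
    S f = X (order_type (fun x => rho (val f x))).
Proof.
move=> minS; have [X hX] := order_limit S.
have closX : in_orbit_closure S (fun s => X (order_type (val s))).
  move=> F; have [g hg] := hX (\max_(f <- F) \max_x val f x).+1.
  exists g => f fF; apply: hg => x; rewrite ltnS.
  apply: leq_trans (leq_bigmax_seq _ fF isT).
  exact: (leq_bigmax (F := val f)).
have closS : in_orbit_closure S S.
  move=> F; have idb : bijective (@id nat) by exists id.
  exists (Aut (E := E) idb (fun _ _ => erefl)) => f _; congr S; apply: val_inj.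
  by apply/ffunP => x; rewrite ffunE.
exists X => F; have [g hg] := minS _ closX _ closS F.
exists g => f fF; rewrite -hg // /act; congr (X _).
by apply/ffunP => u; rewrite !ffunE.
Qed.

(** [k] and [X] are fixed before [F], and only the orders vary with [F]; the final count rests on
    this uniformity. *)
Definition order_definable (S : Emb E A -> bool) :=
  exists (k : nat) (X : seq {ffun A * A -> bool} -> bool),
  forall F : seq (Emb E A), exists rhos : seq (nat -> nat), size rhos = k /\
    forall f, f \in F ->
      S f = X [seq order_type (fun x => rho (val f x)) | rho <- rhos].

Lemma minimal_BA_order_definable (S : Emb E A -> bool) :
  minimal_BA S -> order_definable S.
Proof.
elim=> {S} [S minS||S _ [k [X hX]]|S1 S2 _ [k1 [X1 h1]] _ [k2 [X2 h2]]
           |S S' _ [k [X hX]] SS'].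
- have [X hX] := minimal_order_type minS.
  exists 1, (fun l => if l is o :: _ then X o else false) => F.
  by have [rho hrho] := hX F; exists [:: rho]; split.
- by exists 0, (fun _ => false) => F; exists [::]; split.
- exists k, (fun l => ~~ X l) => F; have [rhos [sk hF]] := hX F.
  by exists rhos; split=> // f /hF ->.
- exists (k1 + k2), (fun l => X1 (take k1 l) || X2 (drop k1 l)) => F.
  have [r1 [s1 hF1]] := h1 F; have [r2 [s2 hF2]] := h2 F.
  exists (r1 ++ r2); rewrite size_cat s1 s2; split=> // f fF.
  by rewrite map_cat take_size_cat ?drop_size_cat ?size_map // hF1 // hF2.
- exists k, X => F; have [rhos [sk hF]] := hX F.
  by exists rhos; split=> // f /hF <-.
Qed.

End Minimal.

(** * Counting order patterns on a blow-up *)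

Lemma order_count_lt (n k : nat) :
  exists2 m, 0 < m & ((n * m).+1 ^ (n * m)) ^ k < 2 ^ (m * m).
Proof.
(* For [m = 2 ^ t] the claim reduces to [c * (n + t) < 2 ^ t]. With [t = 3 * u] this follows from
   [c < 2 ^ u] and [n + t <= 4 * 2 ^ u <= 2 ^ u * 2 ^ u]. *)
pose c := n * k; pose u := c + n + 3; pose t := 3 * u.
have small : c * (n + t) < 2 ^ t.
  have uu : u < 2 ^ u by exact: ltn_expl.
  have cu : c < 2 ^ u by apply: leq_ltn_trans uu; rewrite /u -addnA leq_addr.
  have nt : n + t <= 4 * 2 ^ u.
    rewrite -[4]/(1 + 3) mulnDl mul1n leq_add ?leq_mul2l ?(ltnW uu) //.
    by apply: leq_trans (ltnW uu); rewrite /u -addnA addnCA leq_addr.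
  have eight : 4 <= 2 ^ u by rewrite -[4]/(2 ^ 2) leq_exp2l // /u addnC.
  apply: leq_ltn_trans (leq_mul (leqnn c) nt) _.
  apply: leq_ltn_trans (leq_mul (leqnn c) (leq_mul eight (leqnn _))) _.
  have -> : 2 ^ t = 2 ^ u * (2 ^ u * 2 ^ u) by rewrite -!expnD /t !mulSn addn0.
  by rewrite ltn_pmul2r // muln_gt0 andbb expn_gt0.
exists (2 ^ t); first by rewrite expn_gt0.
have le1 : (n * 2 ^ t).+1 <= 2 ^ (n + t).
  rewrite expnD; apply: (@leq_trans (n.+1 * 2 ^ t)).
    by rewrite mulSn -add1n leq_add2r expn_gt0.
  by rewrite leq_mul2r ltn_expl ?orbT.
apply: (@leq_ltn_trans (2 ^ ((n + t) * (n * 2 ^ t * k)))).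
  by rewrite -expnM [X in _ <= X]expnM; case: (n * 2 ^ t * k) => // e; rewrite leq_exp2r.
rewrite ltn_exp2l // [n * _ * k]mulnAC mulnCA mulnA.
by rewrite ltn_pmul2r ?expn_gt0 // mulnC.
Qed.

Local Open Scope fset_scope.

Theorem mainTheorem7 (r : nat) (E : rel nat) (A2 An : {fset nat})
  (sub : A2 `<=` An) (T : Emb E A2 -> bool) :
  3 <= r ->
  random_Kr_free_graph E r ->
  (exists a b : nat, [/\ a != b, E a b & A2 = [fset a; b]]) ->
  dense_orbit T ->
  ~ minimal_BA (fun s : Emb E An => T (restr sub s)).
Proof.
move=> _ HE [a [b [nab _ A2E]]] dense /(minimal_BA_order_definable HE) [k [X hX]].
have aA2 : a \in A2 by rewrite A2E !inE eqxx.
have bA2 : b \in A2 by rewrite A2E !inE eqxx orbT.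
have [[//|M] _ big] := order_count_lt #|{: An}| k.
(* The blow-up of [An]: copies of one vertex are not adjacent, so cliques project injectively to
   cliques of [An]. *)
pose W := (An * 'I_M.+1)%type.
pose EW : rel W := fun v w => E (val v.1) (val w.1).
have EW_irr : irreflexive EW by move=> v; apply: henson_irr HE _.
have EW_sym : symmetric EW by move=> v w; apply: henson_sym HE _ _.
have EW_kfree : kfree r EW.
  by move=> s us hs; apply: (kfree_size_lt (f := fun v : W => val v.1)
    (henson_irr HE) (henson_kfree HE) us).
have [i [i_inj iE]] := henson_universal HE EW_irr EW_sym EW_kfree.
(* The copy of [An] through the copy [p.1] of [a] and the copy [p.2] of [b]; all other vertices use
   the copy [ord0]. *)
pose pos (p : 'I_M.+1 * 'I_M.+1) (x : An) : W :=
  (x, if val x == a then p.1 else if val x == b then p.2 else ord0).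
have s_proof p : is_emb E [ffun x => i (pos p x)].
  apply/embeddingP; split=> x y; rewrite !ffunE; last exact: iE.
  by move=> /i_inj[].
pose s p : Emb E An := exist (fun f => is_emb E f) _ (s_proof p).
(* The restrictions to [A2] still determine [p], so their membership can be prescribed
   independently. *)
have restr_inj : injective (fun p => restr sub (s p)).
  move=> [p1 p2] [q1 q2] /(congr1 val)/ffunP h.
  have := h [` aA2]; have := h [` bA2]; rewrite !ffunE /= ?ffunE.
  move=> /i_inj/(congr1 snd)/= + /i_inj/(congr1 snd)/=.
  by rewrite !eqxx [b == a]eq_sym (negPf nab) => -> ->.
pose N := (#|{: An}| * M.+1).+1.
have cardW : #|{: W}| = #|{: An}| * M.+1 by rewrite card_prod card_ord.
pose decode (K : k.-tuple {ffun W -> 'I_N}) : {ffun 'I_M.+1 * 'I_M.+1 -> bool} :=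
  [ffun p => X [seq order_type (fun x => kap (pos p x) : nat) | kap : {ffun W -> 'I_N} <- K]].
(* Density moves [T] so that it agrees with [q] on the restrictions; the [k] orders for the moved
   embeddings, pulled back to [W], then decode to [q]. *)
have decode_onto q : q \in codom decode.
  pose psi (f : Emb E A2) := [exists p, (f == restr sub (s p)) && q p].
  have [g hg] := dense psi [seq restr sub (s p) | p <- enum {: 'I_M.+1 * 'I_M.+1}].
  have [rhos [sk hrho]] := hX [seq comp_emb g (s p) | p <- enum {: 'I_M.+1 * 'I_M.+1}].
  pose sig (rho : nat -> nat) (v : W) := rho (g (i v)).
  (* Ranks keep all comparisons and are at most [#|W|], so they fit in ['I_N] and only finitely many
     rank functions occur. *)
  pose rank (rho : nat -> nat) : {ffun W -> 'I_N} :=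
    [ffun v => inord #|[pred w | sig rho w < sig rho v]|].
  have rankE rho v w : (rank rho v < rank rho w) = (sig rho v < sig rho w).
    rewrite !ffunE !inordK ?ltnS -?cardW ?max_card //.
    have [vw|wv] := ltnP (sig rho v) (sig rho w).
      apply: proper_card; apply/properP; split.
        by apply/subsetP => z; rewrite !inE => /ltn_trans; apply.
      by exists v; rewrite !inE ?ltnn.
    apply/negbTE; rewrite -leqNgt; apply: subset_leq_card.
    by apply/subsetP => z; rewrite !inE => zw; apply: leq_trans zw wv.
  have sK : size (map rank rhos) == k by rewrite size_map sk.
  suff -> : q = decode (Tuple sK) by apply: codom_f.
  apply/ffunP => p; rewrite ffunE /=.
  have psiE : psi (restr sub (s p)) = q p.
    apply/existsP/idP => [[p' /andP[/eqP/restr_inj->]] //|qp].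
    by exists p; rewrite eqxx.
  rewrite -psiE -hg; last first.
    by apply: (map_f (fun p => restr sub (s p))); rewrite mem_enum.
  rewrite /act.
  have -> : comp_emb g (restr sub (s p)) = restr sub (comp_emb g (s p)).
    by apply: val_inj; apply/ffunP => x; rewrite !ffunE.
  rewrite hrho; last by apply: map_f; rewrite mem_enum.
  congr (X _); rewrite -map_comp.
  apply: eq_map => rho /=; apply/ffunP => uv.
  by rewrite [LHS]ffunE [RHS]ffunE rankE /sig !ffunE.
(* A surjective [decode] bounds the number of patterns by the number of tuples of rank functions,
   against [big]. *)
have := leq_image_card decode predT.
rewrite leqNgt => /negP; apply.
have -> : #|[seq decode x | x in predT]| = #|{: {ffun 'I_M.+1 * 'I_M.+1 -> bool}}|.
  by apply: eq_card => q; rewrite decode_onto.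
by rewrite card_ffun card_bool card_prod card_ord card_tuple card_ffun cardW card_ord.
Qed.
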